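(* For every constant integer $q\ge4$, any CONGEST algorithm (possibly randomized, succeeding with probability at least $2/3$) that detects whether a directed unweighted $n$-vertex graph contains a directed cycle of length exactly $q$ requires $\Omega\!\left(\frac{n}{\log n}\right)$ rounds in the worst case.
   Context: CONGEST model: the communication network is the graph $G=(V,E)$, $n=|V|$; each node has a unique identifier in $\{0,\dots,n-1\}$, knows its own and its neighbours' identifiers and its incident edges (with their directions); computation proceeds in synchronous rounds in which each node may send a message of $O(\log n)$ bits to each neighbour; local computation is free; communication links are bidirectional even when $G$ is directed. $q$-cycle detection: some vertex must report a cycle if $G$ contains a simple directed cycle of length $q$, and no vertex may report one otherwise. *)

(* Defs.v *)
From mathcomp Require Import all_boot.

Set Implicit Arguments. Unset Strict Implicit. Unset Printing Implicit Defensive.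

(* A directed graph on vertex set 'I_n (identifiers 0..n-1) is a relation
   [e : rel 'I_n], [e u v] meaning there is an arc u -> v. *)

Definition has_dcycle (n q : nat) (e : rel 'I_n) : bool :=
  [exists s : q.-tuple 'I_n, uniq s && cycle e s].

(* A randomized CONGEST algorithm for n-vertex graphs, with B-bit messages
   (a message is either absent or one of 2^B bit strings) and k private random
   bits per node.  Local state space S is arbitrary (local computation is free).
   - init v Nout Nin rnd : initial state of node v, knowing its id, its
     out-neighbours and in-neighbours (with their ids) and its random bits;
   - send s u : message (if any) sent in state s to neighbour u;
   - recv s m : new state given the messages m u received from each node u;
   - out s : whether the node reports a cycle. *)
Record congest_algo (n B k : nat) := CongestAlgo {
  state_t : Type;
  init : 'I_n -> {set 'I_n} -> {set 'I_n} -> k.-tuple bool -> state_t;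
  send : state_t -> 'I_n -> option 'I_(2 ^ B);
  recv : state_t -> ('I_n -> option 'I_(2 ^ B)) -> state_t;
  out  : state_t -> bool
}.
Arguments init {n B k} c _ _ _ _.
Arguments send {n B k} c _ _.
Arguments recv {n B k} c _ _.
Arguments out {n B k} c _.

(* Communication links are bidirectional: u and v can talk iff u->v or v->u. *)
Definition linked (n : nat) (e : rel 'I_n) (u v : 'I_n) : bool := e u v || e v u.

Fixpoint states (n B k : nat) (A : congest_algo n B k) (e : rel 'I_n)
    (r : {ffun 'I_n -> k.-tuple bool}) (t : nat) : 'I_n -> state_t A :=
  match t with
  | 0 => fun v => init A v [set u | e v u] [set u | e u v] (r v)
  | t'.+1 =>
      let s := states A e r t' in
      fun v => recv A (s v) (fun u => if linked e u v then send A (s u) v else None)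
  end.

Definition run_correct (n B k : nat) (A : congest_algo n B k) (q T : nat)
    (e : rel 'I_n) (r : {ffun 'I_n -> k.-tuple bool}) : bool :=
  [exists v, out A (states A e r T v)] == has_dcycle q e.

(* The T-round algorithm detects q-cycles with probability >= 2/3 on every
   (loopless) directed n-vertex graph; random bits are independent and uniform. *)
Definition detects_whp (n B k : nat) (A : congest_algo n B k) (q T : nat) : Prop :=
  forall e : rel 'I_n, irreflexive e ->
    2 * #|{ffun 'I_n -> k.-tuple bool}|
      <= 3 * #|[set r : {ffun 'I_n -> k.-tuple bool} | run_correct A q T e r]|.

(* Main.v *)
(** Split a layered graph whose directed q-cycles are the common elements of
    two sets x, y over N = (n/q)^2 points into two halves joined by O(n) links.
    A T-round algorithm then solves set disjointness on N points with
    O(T n log n) bits of communication, so it suffices to show that randomized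
    disjointness needs Omega(N) bits.

    For the latter, draw a random S, then x inside S and y inside its
    complement.  If a combinatorial rectangle A x B contains a 2^(-eps N) fraction
    of these disjoint pairs, then, for most S and most points j, membership of
    j is nearly unbiased in A below S and in B below the complement of S
    (level-one inequality).  Switching j from absent to present on both sides
    hence turns disjoint pairs of the rectangle into comparably many uniquely
    intersecting ones.  So no small family of rectangles can cover many disjoint
    pairs while covering relatively few intersecting pairs, whereas the transcripts
    of several independent runs all answering "no" would do just that. *)

Require Import Defs.
From mathcomp Require Import all_boot zify.
From Stdlib Require Import FunctionalExtensionality.

Set Implicit Arguments. Unset Strict Implicit. Unset Printing Implicit Defensive.

Lemma leq_exp2rW d a b : a <= b -> a ^ d <= b ^ d.
Proof. by case: d => // d; rewrite leq_exp2r. Qed.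

(** * Set disjointness: balanced points and the level-one inequality *)

Section Disjointness.

Variable I : finType.
Implicit Types (A B : {set {set I}}) (S x y J : {set I}) (i j : I).

Definition below A S := [set x in A | x \subset S].
Definition below_with A S j := [set x in A | (j \in x) && (x \subset S)].

(** For [x] uniform in [below A S], the event that [x] contains [j] then has probability outside
    [1/4, 3/4]. *)
Definition unbalanced A S j :=
  let p0 := #|below A (S :\ j)| in let p1 := #|below_with A S j| in
  (3 * p1 < p0) || (3 * p0 < p1).

Definition unbalanced_set A S := [set j in S | unbalanced A S j].

Lemma subset_exact_card J n :
  n <= #|J| -> exists2 J' : {set I}, J' \subset J & #|J'| = n.
Proof.
move=> nJ; have : 0 < #|[set J' : {set I} | J' \subset J & #|J'| == n]|.
  by rewrite cards_draws bin_gt0.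
by case/card_gt0P=> J'; rewrite inE => /andP[? /eqP]; exists J'.
Qed.

Lemma card_below A S j :
  #|below A S| = #|below A (S :\ j)| + #|below_with A S j|.
Proof.
rewrite -(cardsID [set x : {set I} | j \notin x] (below A S)); congr (_ + _).
  apply: eq_card => x; rewrite !inE subsetD1.
  by rewrite andbA.
by apply: eq_card => x; rewrite !inE negbK andbCA.
Qed.

(** Integer form of a supporting line of the convex function 3^k at k = [m]; summed over a family it
    replaces Jensen's inequality. *)
Lemma exp3_tangent k m : 3 ^ m * k.+1 <= 3 ^ k + 3 ^ m * m.
Proof.
have [km|mk] := leqP k.+1 m; first by nia.
have {}mk : m <= k by [].
rewrite -(subnK mk) expnD; have := ltn_expl (k - m) (isT : 1 < 3); nia.
Qed.

(* Chernoff's method: the sum of 3 ^ (number of agreements with the majority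
   pattern of A) over A is at most the same sum over all subsets of S, and at
   least |A| * 3 ^ (average number of agreements) by convexity. *)
Lemma level_one A S :
  #|below A S| * 27 ^ (#|unbalanced_set A S| %/ 4)
    <= 2 ^ #|S| * 16 ^ (#|unbalanced_set A S| %/ 4).
Proof.
(* Rounding to a multiple of 4 makes the average agreement, at least 3/4 of [#|J|], the integer
   [3 * s]. *)
set s := _ %/ 4.
have [J sJ cJ] : exists2 J : {set I}, J \subset unbalanced_set A S & #|J| = 4 * s.
  by apply: subset_exact_card; rewrite /s; lia.
have JS : J \subset S.
  by apply: subset_trans sJ _; apply/subsetP=> j; rewrite inE => /andP[].
pose c := [set j | #|below A (S :\ j)| < #|below_with A S j|].
pose agree x := \sum_(j in J) ((j \in x) == (j \in c)).
have avg : 3 * s * #|below A S| <= \sum_(x in below A S) agree x.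
  rewrite exchange_big /=.
  have per j : j \in J ->
     3 * #|below A S| <= 4 * \sum_(x in below A S) ((j \in x) == (j \in c)).
    move=> jJ; have := subsetP sJ _ jJ; rewrite inE => /andP[jS].
    rewrite /unbalanced (card_below A S j) => unb.
    suff -> : \sum_(x in below A S) ((j \in x) == (j \in c)) =
       if j \in c then #|below_with A S j| else #|below A (S :\ j)|.
      rewrite inE; case: ltnP; lia.
    rewrite -big_mkcondr sum1_card.
    case: (j \in c); apply: eq_card => x; rewrite !inE ?subsetD1 unfold_in /= !inE.
      by case: (j \in x); rewrite /= ?andbT ?andbF.
    by case: (j \in x); rewrite /= ?andbT ?andbF.
  have : \sum_(j in J) 3 * #|below A S| <=
         \sum_(j in J) 4 * \sum_(x in below A S) ((j \in x) == (j \in c)).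
    by apply: leq_sum.
  rewrite sum_nat_const cJ -big_distrr /=; nia.
(* Extended to all subsets of [S], the sum factors over points: 1 + 3 = 4 for each point of [J], 2
   for each other point of [S]. *)
have cube : \sum_(x in below A S) 3 ^ agree x <= 2 ^ #|S| * 16 ^ s.
  pose w (b : bool) j :=
    (if b then (j \in S : nat) else 1) * (if j \in J then 3 ^ (b == (j \in c)) else 1).
  have -> : 2 ^ #|S| * 16 ^ s = \prod_j (w true j + w false j).
    have -> : 16 ^ s = 2 ^ #|J| by rewrite cJ expnM.
    rewrite -!prod_nat_const (big_mkcond (mem S)) (big_mkcond (mem J)) -big_split /=.
    apply: eq_bigr => j _; rewrite /w; have := subsetP JS j.
    by case: (j \in S); case: (j \in J); case: (j \in c) => // /(_ isT).
  rewrite (bigA_distr 1 addn) /= big_mkcond /=.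
  apply: leq_sum => x _; case: ifP => //; rewrite !inE => /andP[_ /subsetP xS].
  rewrite /agree expn_sum big_mkcond /=; apply: eq_leq; apply: eq_bigr => j _.
  rewrite /w; have := xS j; case: (j \in x) => [->//|_]; by rewrite mul1n.
have tan : \sum_(x in below A S) 3 ^ (3 * s) * (agree x).+1 <=
    \sum_(x in below A S) (3 ^ agree x + 3 ^ (3 * s) * (3 * s)).
  by apply: leq_sum => x _; apply: exp3_tangent.
move: tan; rewrite big_split sum_nat_const -big_distrr /=.
rewrite (eq_bigr (fun x => agree x + 1)); last by move=> x _; rewrite addn1.
rewrite big_split /= sum1_card (_ : 27 = 3 ^ 3) // -expnM.
move: avg cube; set X := \sum_(x in _) agree x; set Y := \sum_(x in _) 3 ^ _.
set a := #|_|; set e := 3 ^ _; set Z := _ * 16 ^ _; nia.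
Qed.

(** * Weights of disjoint and of intersecting pairs *)

Lemma card_set_type : #|{: {set I}}| = 2 ^ #|I|.
Proof. by rewrite -(cardsT I) -card_powerset powersetT cardsT. Qed.

(* Up to normalization, the probability of (x, y) when x and y are uniform
   subsets of a random S and of its complement; in meet_weight the same with a
   random point j forced into both. *)
Definition disjoint_weight x y := #|[set S : {set I} | (x \subset S) && (y \subset ~: S)]|.

Definition meet_weight x y :=
  \sum_j #|[set S : {set I} | [&& j \in S, j \in x, x \subset S, j \in y
                                & y \subset j |: ~: S]]|.

Lemma disjoint_weightE A B :
  \sum_(x in A) \sum_(y in B) disjoint_weight x y =
  \sum_S #|below A S| * #|below B (~: S)|.
Proof.
under eq_bigr => x _ do under eq_bigr => y _ do
  rewrite /disjoint_weight -sum1_card big_mkcond /=.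
under eq_bigr => x _ do rewrite exchange_big /=.
rewrite exchange_big /=; apply: eq_bigr => S _.
rewrite -!sum1_card big_distrl /= [RHS]big_mkcond [LHS]big_mkcond /=.
apply: eq_bigr => x _; rewrite inE; case: (x \in A) => //=.
rewrite mul1n [X in if _ then X else _]big_mkcond [LHS]big_mkcond /=.
case xS : (x \subset S).
  by apply: eq_bigr => y _; rewrite !inE xS; case: (y \in B).
by rewrite big1 // => y _; rewrite !inE xS; case: (y \in B).
Qed.

Lemma meet_weightE A B :
  \sum_(x in A) \sum_(y in B) meet_weight x y =
  \sum_j \sum_(S : {set I} | j \in S) #|below_with A S j| * #|below_with B (j |: ~: S) j|.
Proof.
rewrite /meet_weight.
under eq_bigr => x _ do rewrite exchange_big /=.
rewrite exchange_big /=; apply: eq_bigr => j _.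
under eq_bigr => x _ do under eq_bigr => y _ do
  rewrite -sum1_card big_mkcond /=.
under eq_bigr => x _ do rewrite exchange_big /=.
rewrite exchange_big [RHS]big_mkcond /=; apply: eq_bigr => S _.
case jS : (j \in S); last first.
  by rewrite big1 // => x _; rewrite big1 // => y _; rewrite !inE jS.
rewrite -!sum1_card big_distrl /= [RHS]big_mkcond [LHS]big_mkcond /=.
apply: eq_bigr => x _; rewrite inE; case: (x \in A) => //=.
rewrite mul1n [X in if _ then X else _]big_mkcond [LHS]big_mkcond /=.
case xS : ((j \in x) && (x \subset S)).
  apply: eq_bigr => y _; rewrite !inE jS /=; case/andP: xS => -> ->.
  by case: (y \in B).
rewrite big1 // => y _; rewrite !inE jS /= andbA xS; by case: (y \in B).
Qed.

Lemma disjoint_weight_gt0 x y : 0 < disjoint_weight x y -> [disjoint x & y].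
Proof.
case/card_gt0P=> S; rewrite inE => /andP[xS yS].
rewrite disjoints_subset; apply: (subset_trans xS).
by rewrite -(setCK S) setCS.
Qed.

Lemma meet_weight_gt0 x y : 0 < meet_weight x y -> exists2 j, j \in x & j \in y.
Proof.
rewrite lt0n sum_nat_eq0 => /forallPn[j]; rewrite -lt0n => /card_gt0P[S].
by rewrite inE => /and5P[_ jx _ jy _]; exists j.
Qed.

(** * Corruption bound for a single rectangle *)

Lemma sum_split_at j (F : {set I} -> nat) :
  \sum_S F S = \sum_(S : {set I} | j \in S) (F S + F (S :\ j)).
Proof.
rewrite big_split (bigID (fun S : {set I} => j \in S)) /=; congr (_ + _).
rewrite (reindex_onto (fun S : {set I} => S :\ j) (fun S => j |: S)) /=; last first.
  by move=> S jS; rewrite setU1K.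
apply: eq_bigl => S; rewrite !inE eqxx /=.
by apply/eqP/idP => [<-|jS]; rewrite ?setU11 ?setD1K.
Qed.

(** Let p0, p1 (q0, q1) count the sets without and with [j] on the side of [A] (of [B]). The left
    side is 2 p0 q0 + p1 q0 + p0 q1. If [j] is balanced on both sides, comparing each term with p1
    q1 costs 2 * 9 + 3 + 3 = 24; otherwise an unbalanced side pays, at cost at most 2 + 3 = 5. *)
Lemma rectangle_pairs A B j S (M := fun S => #|below A S| * #|below B (~: S)|) :
  j \in S ->
  M S + M (S :\ j) <=
    24 * (#|below_with A S j| * #|below_with B (j |: ~: S) j|) +
    5 * (unbalanced A S j * M S + unbalanced B (~: (S :\ j)) j * M (S :\ j)).
Proof.
move=> jS; rewrite /M.
have CE : ~: (S :\ j) = j |: ~: S by rewrite setCD setUC.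
rewrite CE (card_below A S j) (card_below B (j |: ~: S) j) /unbalanced.
have -> : (j |: ~: S) :\ j = ~: S by rewrite setU1K // inE jS.
set p0 := #|below A _|; set p1 := #|below_with A _ _|.
set q0 := #|below B _|; set q1 := #|below_with B _ _|.
case: (boolP ((3 * p1 < p0) || _)) => Hp; case: (boolP ((3 * q1 < q0) || _)) => Hq /=;
  rewrite ?mul1n ?mul0n ?addn0 ?add0n.
- lia.
- move: Hq; rewrite negb_or -!leqNgt => /andP[]; nia.
- move: Hp; rewrite negb_or -!leqNgt => /andP[]; nia.
- move: Hp Hq; rewrite !negb_or -!leqNgt => /andP[h1 h2] /andP[h3 h4].
  have := leq_mul h1 h3; have := leq_mul h1 h4; have := leq_mul h2 h3. nia.
Qed.

Lemma rectangle_unbalanced A B :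
  #|I| * \sum_S #|below A S| * #|below B (~: S)| <=
  24 * (\sum_(x in A) \sum_(y in B) meet_weight x y) +
  5 * \sum_S (#|unbalanced_set A S| + #|unbalanced_set B (~: S)|) *
               (#|below A S| * #|below B (~: S)|).
Proof.
pose M S := #|below A S| * #|below B (~: S)|.
have lhs : #|I| * \sum_S M S = \sum_j \sum_(S : {set I} | j \in S) (M S + M (S :\ j)).
  rewrite -sum_nat_const; apply: eq_bigr => j _; exact: sum_split_at.
have rhs : \sum_S (#|unbalanced_set A S| + #|unbalanced_set B (~: S)|) * M S =
    \sum_j \sum_(S : {set I} | j \in S)
      (unbalanced A S j * M S + unbalanced B (~: (S :\ j)) j * M (S :\ j)).
  pose F j S := (if j \in S then unbalanced A S j else unbalanced B (~: S) j) * M S.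
  transitivity (\sum_j \sum_S F j S).
    rewrite exchange_big; apply: eq_bigr => S _; rewrite -big_distrl /=; congr (_ * _).
    rewrite -!sum1_card [X in X + _]big_mkcond [X in _ + X]big_mkcond -big_split /=.
    apply: eq_bigr => j _.
    rewrite !inE; case: (j \in S) => /=; rewrite ?addn0 ?add0n; by case: unbalanced.
  apply: eq_bigr => j _; rewrite (sum_split_at j); apply: eq_bigr => S jS.
  by rewrite /F jS !inE eqxx.
rewrite lhs rhs meet_weightE !big_distrr -big_split /=; apply: leq_sum => j _.
rewrite !big_distrr -big_split /=; apply: leq_sum => S; exact: rectangle_pairs.
Qed.

(** Rests on 2 * 16^2 <= 27^2: two factors 27/16 gain one bit. *)
Lemma pow27_16 w h : 2 * h <= w -> 2 ^ h * 16 ^ w <= 27 ^ w.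
Proof.
move=> hw; rewrite -(subnK hw) [16 ^ _]expnD [27 ^ _]expnD [16 ^ (2 * h)]expnM [27 ^ (2 * h)]expnM.
rewrite mulnCA; apply: leq_mul; first exact: leq_exp2rW.
rewrite -expnMn; exact: leq_exp2rW.
Qed.

(** Sets [S] with at most [#|I|]/10 unbalanced points in total absorb at most half of the left side
    of [rectangle_unbalanced]; for the others the level-one inequality, applied on both sides, makes
    the mass exponentially small. The [- 2] in [h] covers the rounding in the two divisions by 4. *)
Lemma corruption A B (h := #|I| %/ 80 - 2) :
  2 ^ h * (#|I| * \sum_(x in A) \sum_(y in B) disjoint_weight x y) <=
  48 * 2 ^ h * (\sum_(x in A) \sum_(y in B) meet_weight x y) + 10 * #|I| * 4 ^ #|I|.
Proof.
have := rectangle_unbalanced A B; rewrite disjoint_weightE.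
set n := #|I|; set D := \sum_S _; set E := \sum_(x in A) _; set W := \sum_S _ * _ => nD.
suff : 10 * (2 ^ h * W) <= n * (2 ^ h * D) + 10 * n * 4 ^ n by nia.
rewrite (_ : 4 ^ n = \sum_(S : {set I}) 2 ^ n); last first.
  by rewrite sum_nat_const card_set_type -expnMn.
rewrite !big_distrr -big_split /=; apply: leq_sum => S _.
set u := #|unbalanced_set A S|; set v := #|unbalanced_set B _|; set M := _ * #|below B _|.
have cS : 2 ^ #|S| * 2 ^ #|~: S| = 2 ^ n by rewrite -expnD cardsC.
have uv : u + v <= n.
  rewrite /n -(cardsC S); apply: leq_add; apply: subset_leq_card;
  by apply/subsetP => j; rewrite inE => /andP[].
have [small|big] := leqP (10 * (u + v)) n.
  by move: (2 ^ h) (2 ^ n) => p q; have := leq_mul small (leqnn (p * M)); nia.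
suff pMq : 2 ^ h * M <= 2 ^ n.
  by have := leq_mul uv pMq; move: (2 ^ h) (2 ^ n) => p q; nia.
have lA := level_one A S; have lB := level_one B (~: S).
have {lA lB} := leq_mul lA lB; rewrite mulnACA [X in _ <= X]mulnACA cS.
rewrite -[27 ^ _ * _]expnD -[16 ^ _ * _]expnD.
rewrite -/u -/v -/M; set w := _ %/ 4 + _ => lM.
have hw : 2 * h <= w by rewrite /h /w -/n; lia.
have := pow27_16 hw; have : 0 < 16 ^ w by rewrite expn_gt0.
move=> a_gt0 hb; rewrite -(leq_pmul2r a_gt0); apply: leq_trans lM.
by rewrite (mulnC _ M) -mulnA leq_mul2l hb orbT.
Qed.

Lemma sum_disjoint_weight :
  \sum_x \sum_y disjoint_weight x y = 4 ^ #|I|.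
Proof.
have := disjoint_weightE setT setT.
under eq_bigr => x _ do under eq_bigl => y do rewrite inE.
under eq_bigl => x do rewrite inE.
move=> ->; rewrite (eq_bigr (fun=> 2 ^ #|I|)); last first.
  move=> S _; rewrite -(cardsC S) expnD -!card_powerset.
  by congr (_ * _); apply: eq_card => x; rewrite !inE.
by rewrite sum_nat_const card_set_type -expnMn.
Qed.

(** With n = [#|I|], each [j] lies in 2^(n-1) sets [S], and each of these admits 2^(n-1) pairs with
    [j] forced into both sets. *)
Lemma sum_meet_weight :
  4 * \sum_x \sum_y meet_weight x y = #|I| * 4 ^ #|I|.
Proof.
have := meet_weightE setT setT.
under eq_bigr => x _ do under eq_bigl => y do rewrite inE.
under eq_bigl => x do rewrite inE.
move=> ->; rewrite -sum_nat_const big_distrr /=; apply: eq_bigr => j _.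
have half S : j \in S -> 2 * #|below_with setT S j| = 2 ^ #|S|.
  move=> jS; rewrite -card_powerset.
  have cT (S' : {set I}) : #|below setT S'| = 2 ^ #|S'|.
    by rewrite -card_powerset; apply: eq_card => x; rewrite !inE.
  have := card_below setT S j; rewrite card_powerset !cT (cardsD1 j S) jS expnS; lia.
have -> : 4 ^ #|I| = \sum_(S : {set I}) 2 ^ #|I|.
  by rewrite sum_nat_const card_set_type -expnMn.
rewrite (sum_split_at j) big_distrr /=; apply: eq_bigr => S jS.
have jC : j \in j |: ~: S by rewrite setU11.
rewrite (_ : 4 = 2 * 2) // mulnACA half // half // cardsU1 inE jS expnD.
by rewrite mulnCA -expnD cardsC mul2n addnn.
Qed.

(** * From rectangles to randomized protocols *)

Definition rectangular (Th : eqType) (tr : {set I} -> {set I} -> Th) :=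
  forall x y x' y', tr x y = tr x' y' -> tr x y' = tr x y.

(** Rectangularity makes each fibre of [tr] the product of its two projections. *)
Lemma sum_by_rectangles (Th : finType) (tr : {set I} -> {set I} -> Th)
    (acc : pred Th) (F : {set I} -> {set I} -> nat) :
  rectangular tr ->
  \sum_x \sum_(y | acc (tr x y)) F x y =
  \sum_(t | acc t) \sum_(x in [set x | [exists y, tr x y == t]])
    \sum_(y in [set y | [exists x, tr x y == t]]) F x y.
Proof.
move=> rect.
have rectE t x y : (x \in [set x | [exists y, tr x y == t]]) &&
    (y \in [set y | [exists x, tr x y == t]]) = (tr x y == t).
  rewrite !inE; apply/andP/idP => [[/existsP[y1 /eqP e1] /existsP[x1 /eqP e2]]|e].
    by rewrite (rect _ y1 x1) e1 ?e2.
  by split; apply/existsP; [exists y|exists x].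
transitivity (\sum_(t | acc t) \sum_x \sum_(y | tr x y == t) F x y).
  rewrite exchange_big /=; apply: eq_bigr => x _.
  rewrite (partition_big (tr x) acc) //=; apply: eq_bigr => t acct.
  by apply: eq_bigl => y; apply: andb_idl => /eqP->.
apply: eq_bigr => t _; rewrite [RHS]big_mkcond; apply: eq_bigr => x _ /=.
case: ifP => xt.
  by apply: eq_bigl => y; rewrite -rectE xt.
by rewrite big_pred0 // => y; rewrite -rectE xt.
Qed.

Lemma protocol_corruption (Th : finType) (tr : {set I} -> {set I} -> Th)
    (acc : pred Th) (h := #|I| %/ 80 - 2) :
  rectangular tr ->
  2 ^ h * (#|I| * \sum_x \sum_(y | acc (tr x y)) disjoint_weight x y) <=
  48 * 2 ^ h * (\sum_x \sum_(y | acc (tr x y)) meet_weight x y)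
    + 10 * #|I| * 4 ^ #|I| * #|Th|.
Proof.
move=> rect; rewrite !sum_by_rectangles // !big_distrr /=.
apply: (@leq_trans (\sum_(t | acc t) (48 * 2 ^ h *
    (\sum_(x in [set x | [exists y, tr x y == t]])
       \sum_(y in [set y | [exists x, tr x y == t]]) meet_weight x y)
    + 10 * #|I| * 4 ^ #|I|))).
  by apply: leq_sum => t _; apply: corruption.
rewrite big_split /= leq_add2l sum_nat_cond_const mulnC leq_mul2l.
by rewrite max_card orbT.
Qed.

Section Randomized.

Variables (Om Th : finType) (tr : Om -> {set I} -> {set I} -> Th) (acc : pred Th).
Hypothesis tr_rect : forall w, rectangular (tr w).

Let accepts k x y :=
  [set f : {ffun 'I_k -> Om} | [forall i, acc (tr (f i) x y)]].

Lemma card_accepts k x y : #|accepts k x y| = #|[set w | acc (tr w x y)]| ^ k.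
Proof.
rewrite -[in RHS](card_ord k) -card_ffun_on; apply: eq_card => f.
rewrite inE; apply/forallP/ffun_onP => H i; have := H i; by rewrite inE.
Qed.

(** For fixed coins [f] the vector of [k] transcripts is again rectangular, with [#|Th| ^ k]
    possible values; the bound for one protocol is then summed over [f]. *)
Lemma amplified_corruption k (h := #|I| %/ 80 - 2) :
  2 ^ h * (#|I| * \sum_x \sum_y #|accepts k x y| * disjoint_weight x y) <=
  48 * 2 ^ h * (\sum_x \sum_y #|accepts k x y| * meet_weight x y)
    + 10 * #|I| * 4 ^ #|I| * #|Th| ^ k * #|Om| ^ k.
Proof.
pose trk (f : {ffun 'I_k -> Om}) x y := [ffun i => tr (f i) x y] : {ffun 'I_k -> Th}.
pose acck (g : {ffun 'I_k -> Th}) := [forall i, acc (g i)].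
have trk_rect f : rectangular (trk f).
  move=> x y x' y' /ffunP e; apply/ffunP => i; have := e i; rewrite !ffunE; exact: tr_rect.
have acckE f x y : acck (trk f x y) = (f \in accepts k x y).
  by rewrite inE; apply: eq_forallb => i; rewrite ffunE.
have swap F : \sum_x \sum_y #|accepts k x y| * F x y =
    \sum_f \sum_x \sum_(y | acck (trk f x y)) F x y.
  rewrite [RHS]exchange_big /=; apply: eq_bigr => x _.
  under [RHS]eq_bigr => f _ do rewrite big_mkcond.
  rewrite [RHS]exchange_big /=; apply: eq_bigr => y _.
  rewrite -sum_nat_const [LHS]big_mkcond /=; apply: eq_bigr => f _; by rewrite acckE.
rewrite !swap !big_distrr /=.
have -> : 10 * #|I| * 4 ^ #|I| * #|Th| ^ k * #|Om| ^ k =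
    \sum_(f : {ffun 'I_k -> Om}) 10 * #|I| * 4 ^ #|I| * #|Th| ^ k.
  by rewrite sum_nat_const card_ffun card_ord mulnC.
rewrite -big_split /=; apply: leq_sum => f _.
have := protocol_corruption acck (trk_rect f); by rewrite card_ffun card_ord.
Qed.

(* Five independent repetitions turn the acceptance ratio 2 into 32, which
   beats the constant of the corruption bound. *)
Theorem disjointness_lower_bound :
  0 < #|I| -> 0 < #|Om| ->
  (forall x y, [disjoint x & y] ->
     2 * #|Om| <= 3 * #|[set w | acc (tr w x y)]|) ->
  (forall x y j, j \in x -> j \in y -> 3 * #|[set w | acc (tr w x y)]| <= #|Om|) ->
  2 ^ (#|I| %/ 80) <= 2 ^ 9 * #|Th| ^ 5.
Proof.
move=> I_gt0 Om_gt0 yes no.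
have := amplified_corruption 5; set h := _ - 2.
set X := \sum_x _; set Y := \sum_x _ => XY.
have HX : 32 * #|Om| ^ 5 * 4 ^ #|I| <= 243 * X.
  rewrite -sum_disjoint_weight /X !big_distrr /=; apply: leq_sum => x _.
  rewrite !big_distrr /=; apply: leq_sum => y _; rewrite mulnA.
  have [->|/disjoint_weight_gt0 dxy] := posnP (disjoint_weight x y); first by rewrite !muln0.
  rewrite leq_mul2r card_accepts; apply/orP; right.
  have := leq_exp2rW 5 (yes _ _ dxy); by rewrite !expnMn.
have HY : 243 * 4 * Y <= #|Om| ^ 5 * (#|I| * 4 ^ #|I|).
  rewrite -sum_meet_weight /Y !big_distrr /=; apply: leq_sum => x _.
  rewrite !big_distrr /=; apply: leq_sum => y _.
  have [->|/meet_weight_gt0[j jx jy]] := posnP (meet_weight x y); first by rewrite !muln0.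
  have := leq_exp2rW 5 (no _ _ _ jx jy); rewrite card_accepts expnMn.
  rewrite (_ : 3 ^ 5 = 243) //.
  by move: (_ ^ 5) (#|Om| ^ 5) (meet_weight _ _) => a b c ab; have := leq_mul ab (leqnn (4 * c)); nia.
set Q := #|I| * 4 ^ #|I|; set P := #|Om| ^ 5.
have Q0 : 0 < Q by rewrite muln_gt0 I_gt0 expn_gt0.
have P0 : 0 < P by rewrite expn_gt0 Om_gt0.
(* After multiplication by 243 = 3^5, the left side keeps a factor 32 and the intersecting pairs
   only 48/4 = 12, so the error term must pay for the remaining 20. *)
have main : 2 * 2 ^ h <= 243 * #|Th| ^ 5.
  have e1 : 32 * 2 ^ h * (P * Q) <= 243 * (2 ^ h * (#|I| * X)).
    have := leq_mul (leqnn (2 ^ h * #|I|)) HX; rewrite -/P /Q.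
    by clear; move: (2 ^ h) P (4 ^ _) X => a b c d; nia.
  have e2 : 243 * (48 * 2 ^ h * Y) <= 12 * 2 ^ h * (P * Q).
    have := leq_mul (leqnn (12 * 2 ^ h)) HY; rewrite -/P -/Q.
    by clear; move: (2 ^ h) P Q Y => a b c d; nia.
  have e3 : 32 * 2 ^ h * (P * Q) <= 12 * 2 ^ h * (P * Q) + 2430 * #|Th| ^ 5 * (P * Q).
    have -> : 2430 * #|Th| ^ 5 * (P * Q) = 243 * (10 * #|I| * 4 ^ #|I| * #|Th| ^ 5 * P).
      by rewrite /Q; clear; move: P (4 ^ _) (#|Th| ^ 5) => a b c; nia.
    apply: (leq_trans e1); apply: leq_trans (leq_add e2 (leqnn _)).
    by rewrite -mulnDr leq_mul2l XY orbT.
  have PQ0 : 0 < P * Q by rewrite muln_gt0 P0.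
  move: e3; rewrite -mulnDl leq_pmul2r //.
  by move: (2 ^ h) (#|Th| ^ 5) => a b; lia.
have : 2 ^ (#|I| %/ 80) <= 2 ^ (h + 2) by rewrite leq_exp2l // /h; lia.
rewrite expnD; move: main; move: (2 ^ h) (2 ^ _) (#|Th| ^ 5) => a b c.
by rewrite (_ : 2 ^ 9 = 512) //; lia.
Qed.

End Randomized.

End Disjointness.

(** * Cut and paste for CONGEST executions *)

Section CutAndPaste.

Variables (n B k T : nat) (A : congest_algo n B k).
Variable r : {ffun 'I_n -> k.-tuple bool}.
Variables (C : finType) (cut : C -> 'I_n * 'I_n) (side : pred 'I_n).

(** The two final bits let the overall verdict be read off the transcript. *)
Definition transcript (e : rel 'I_n) :
    {ffun 'I_T * C -> option 'I_(2 ^ B)} * (bool * bool) :=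
  ([ffun p : 'I_T * C => send A (states A e r p.1 (cut p.2).1) (cut p.2).2],
   ([exists v, side v && out A (states A e r T v)],
    [exists v, ~~ side v && out A (states A e r T v)])).

Lemma transcript_reports e :
  [exists v, out A (states A e r T v)] = (transcript e).2.1 || (transcript e).2.2.
Proof.
apply/existsP/orP => [[v ov]|[]/existsP[v /andP[_ ov]]]; try by exists v.
by case sv : (side v); [left|right]; apply/existsP; exists v; rewrite sv.
Qed.

Variables e e' f : rel 'I_n.
Hypothesis fe : forall u v, side u || side v -> f u v = e u v.
Hypothesis fe' : forall u v, ~~ side u || ~~ side v -> f u v = e' u v.
Hypothesis cutP :
  forall u v, side u != side v -> linked f u v -> exists c, cut c = (u, v).
Hypothesis same : transcript e = transcript e'.

Lemma same_message t u v : t < T -> side u != side v -> linked f u v ->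
  send A (states A e r t u) v = send A (states A e' r t u) v.
Proof.
move=> tT suv /(cutP suv)[c cE].
have /ffunP/(_ (Ordinal tT, c)) := congr1 fst same; by rewrite !ffunE cE.
Qed.

(** Induction on rounds: in [f] a node has the links of its own side's graph; messages from its side
    agree by induction, and those across the cut because the two transcripts coincide. *)
Lemma states_cut_paste t : t <= T -> forall v,
  states A f r t v = if side v then states A e r t v else states A e' r t v.
Proof.
elim: t => [_|t IH tT] v.
  rewrite /=; case: ifPn => sv; congr (init A v _ _ _); apply/setP => u; rewrite !inE.
  - by rewrite fe ?sv.
  - by rewrite fe ?sv ?orbT.
  - by rewrite fe' ?sv.
  - by rewrite fe' ?sv ?orbT.
have {}IH := IH (ltnW tT); rewrite /= IH; case: ifPn => sv; congr (recv A _ _);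
  apply: functional_extensionality => u; rewrite IH.
- have -> : linked e u v = linked f u v by rewrite /linked !fe ?sv ?orbT.
  case: ifP => // luv; case: ifPn => // su; symmetry.
  by apply: same_message => //; rewrite sv (negbTE su).
- have -> : linked e' u v = linked f u v by rewrite /linked !fe' ?sv ?orbT.
  case: ifP => // luv; case: ifPn => // su.
  by apply: same_message => //; rewrite su (negbTE sv).
Qed.

Lemma transcript_cut_paste : transcript f = transcript e.
Proof.
have [same1 same2 same3] := same.
congr (_, (_, _)).
- apply/ffunP => p; rewrite !ffunE states_cut_paste; last exact: ltnW.
  by case: ifP => // _; move/ffunP: same1 => /(_ p); rewrite !ffunE.
- by apply: eq_existsb => v; rewrite states_cut_paste //; case: (side v).
- by rewrite same3; apply: eq_existsb => v; rewrite states_cut_paste //; case: (side v).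
Qed.

End CutAndPaste.

(** * Directed cycles in layered graphs *)

Lemma cycle_nthP (V : Type) (e : rel V) (x0 : V) (s : seq V) :
  reflect (forall i, i < size s -> e (nth x0 s i) (nth x0 s (i.+1 %% size s)))
          (cycle e s).
Proof.
case: s => [|x p]; first by constructor.
have nthE i : i <= size p ->
  (nth x0 (x :: rcons p x) i = nth x0 (x :: p) i) *
  (nth x0 (rcons p x) i = nth x0 (x :: p) (i.+1 %% (size p).+1)).
  move=> ip; split; first by rewrite -rcons_cons nth_rcons /= ltnS ip.
  rewrite nth_rcons; case: ltngtP ip => // [lt_ip|->] _; last by rewrite modnn.
  by rewrite modn_small.
apply: (iffP (pathP x0)) => /= H i; rewrite ?size_rcons => ip; have := H i.
  by rewrite size_rcons => /(_ ip); rewrite !nthE.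
by rewrite ltnS in ip; rewrite ltnS !nthE //; apply.
Qed.

(* The hard instances: q cyclically arranged layers of m vertices, vertex
   l * m + i being number i of layer l.  Consecutive layers are joined by the
   identity matching, except that layers 0 -> 1 are joined by the bipartite
   graph x and layers 2 -> 3 by the transpose of y. *)
Section LayeredGraph.

Variables (n' m' q : nat).
Local Notation m := m'.+1.
Local Notation n := n'.+1.
Hypothesis q_ge4 : 4 <= q.
Hypothesis qm_le_n : q * m <= n.

Definition layer (u : 'I_n) : nat := u %/ m.
Definition label (u : 'I_n) : 'I_m := inord (u %% m).
Definition node (l : nat) (i : 'I_m) : 'I_n := inord (l * m + i).

Definition layer_arc (x y : {set 'I_m * 'I_m}) : rel 'I_n := fun u v =>
  [&& layer u < q, layer v == (layer u).+1 %% q &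
      if layer u == 0 then (label u, label v) \in x
      else if layer u == 2 then (label v, label u) \in y
      else label u == label v].

Lemma node_layer_label u : node (layer u) (label u) = u.
Proof.
by apply: val_inj; rewrite /= inordK inordK ?ltn_mod // -divn_eq.
Qed.

Lemma val_node l i : l < q -> node l i = l * m + i :> nat.
Proof. by move=> lq; rewrite inordK //; have := ltn_ord i; nia. Qed.

Lemma layer_node l i : l < q -> layer (node l i) = l.
Proof. by move=> lq; rewrite /layer val_node // divnMDl // divn_small ?addn0. Qed.

Lemma label_node l i : l < q -> label (node l i) = i.
Proof.
move=> lq; apply: val_inj; rewrite /label /= val_node // modnMDl modn_small //.
by rewrite inordK.
Qed.

(** All arcs depending on [x] stay inside layers 0 and 1, and, since [q] is at least 4, all arcs
    depending on [y] stay outside; only the identity matchings 1 -> 2 and q-1 -> 0 cross. *)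
Definition alice : pred 'I_n := fun u => layer u < 2.

Lemma succ_mod l : l < q -> l.+1 %% q = if l == q.-1 then 0 else l.+1.
Proof.
move=> lq; case: eqP => [->|]; first by rewrite prednK ?modnn //; lia.
by move=> ?; rewrite modn_small //; lia.
Qed.

Lemma layer_arc_alice x y y' u v : alice u || alice v -> layer_arc x y u v = layer_arc x y' u v.
Proof.
rewrite /alice /layer_arc => a; case: ltnP => //= lq; rewrite succ_mod //.
case: eqP => //= lv; case: ifP => // _; case: eqP => // lu.
by move: a; rewrite lv lu; case: eqP => //; lia.
Qed.

Lemma layer_arc_bob x x' y u v : ~~ alice u || ~~ alice v -> layer_arc x y u v = layer_arc x' y u v.
Proof.
rewrite /alice /layer_arc => a; case: ltnP => //= lq; rewrite succ_mod //.
case: eqP => //= lv; case: eqP => // lu.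
by move: a; rewrite lv lu; case: eqP => //; lia.
Qed.

Lemma layer_arc_irreflexive x y : irreflexive (layer_arc x y).
Proof.
move=> u; rewrite /layer_arc; case: ltnP => //= lq; rewrite succ_mod //.
by case: eqP => //=; case: eqP; lia.
Qed.

Definition cut (c : 'I_m * bool * bool) : 'I_n * 'I_n :=
  let p := if c.1.2 then (node 1 c.1.1, node 2 c.1.1)
           else (node q.-1 c.1.1, node 0 c.1.1) in
  if c.2 then p else (p.2, p.1).

Lemma layer_arc_cut x y u v : alice u != alice v -> layer_arc x y u v ->
  exists c, cut (c, true) = (u, v).
Proof.
rewrite /alice => sides; have {sides} a : (layer u < 2 <= layer v) || (layer v < 2 <= layer u).
  by move: sides; rewrite !(leqNgt 2); do 2 case: (_ < 2).
move=> /and3P[lq /eqP]; rewrite succ_mod // => lv.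
have [lu _|lu0] := eqVneq (layer u) 0.
  by move: a; rewrite lv lu; case: eqP; lia.
have [lu _|lu2 /eqP lab] := eqVneq (layer u) 2.
  by move: a; rewrite lv lu; case: eqP; lia.
have [lu|lu1] := eqVneq (layer u) 1.
  have lv2 : layer v = 2 by rewrite lv lu; case: eqP; lia.
  exists (label u, true); rewrite /cut /=.
  by rewrite -[u in RHS]node_layer_label -[v in RHS]node_layer_label lu lv2 lab.
have lu : layer u = q.-1 by move: a; rewrite lv; case: eqP; lia.
have lv0 : layer v = 0 by rewrite lv lu eqxx.
exists (label u, false); rewrite /cut /=.
by rewrite -[u in RHS]node_layer_label -[v in RHS]node_layer_label lu lv0 lab.
Qed.

Lemma linked_cut x y u v : alice u != alice v -> linked (layer_arc x y) u v ->
  exists c, cut c = (u, v).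
Proof.
move=> a /orP[uv|vu]; first by have [c cE] := layer_arc_cut a uv; exists (c, true).
rewrite eq_sym in a; have [c] := layer_arc_cut a vu.
by rewrite /cut /= => cE; exists (c, false); rewrite /cut /= cE.
Qed.

Lemma meeting_has_dcycle (x y : {set 'I_m * 'I_m}) i j : (i, j) \in x -> (i, j) \in y ->
  has_dcycle q (layer_arc x y).
Proof.
(* The cycle has label [j] on layers 1 and 2 and label [i] elsewhere: it uses (i, j) once in [x] and
   once, transposed, in [y]. *)
move=> ijx ijy; pose c l := if (l == 1) || (l == 2) then j else i.
pose s := mkseq (fun l => node l (c l)) q.
have size_s : size s == q by rewrite size_mkseq.
apply/existsP; exists (Tuple size_s); apply/andP; split.
  apply: (map_uniq (f := layer)); rewrite -map_comp.
  rewrite (eq_in_map _ id _).1 ?map_id ?iota_uniq // => l; rewrite mem_iota add0n /= => lq.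
  by rewrite layer_node.
apply/(cycle_nthP _ (node 0 i)); rewrite /= size_mkseq => l lq.
have lq' : l.+1 %% q < q by rewrite ltn_mod; lia.
rewrite !nth_mkseq // /layer_arc !layer_node // !label_node // lq eqxx /= succ_mod //.
rewrite /c; case: l lq lq' => [|[|[|l]]] lq lq' /=; by case: (_ =P q.-1) => //= ?; exfalso; lia.
Qed.

(** Every arc advances the layer by one, so a [q]-cycle goes once around; the matchings force equal
    labels on layers 1 and 2, and on layers 3 to q-1 and 0, so one pair lies in both [x] and [y]. *)
Lemma disjoint_no_dcycle (x y : {set 'I_m * 'I_m}) :
  [disjoint x & y] -> ~~ has_dcycle q (layer_arc x y).
Proof.
move=> dxy; apply/negP => /existsP[s /andP[_ /(cycle_nthP _ (node 0 ord0))]].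
rewrite size_tuple => H; pose v l := nth (node 0 ord0) s (l %% q).
have q0 : 0 < q by lia.
have {H} step l : layer_arc x y (v l) (v l.+1).
  have := H (l %% q); rewrite ltn_mod => /(_ q0).
  by rewrite /v -[(l %% q).+1]addn1 modnDml addn1.
have lq l : layer (v l) < q by case/and3P: (step l).
(* Shifting by [o] makes the closed walk start in layer 0. *)
pose o := q - layer (v 0).
have layer0 l : layer (v l) = (layer (v 0) + l) %% q.
  elim: l => [|l IH]; first by rewrite addn0 modn_small.
  case/and3P: (step l) => _ /eqP -> _.
  by rewrite IH -[(_ %% q).+1]addn1 modnDml addn1 addnS.
pose w l := v (o + l).
have layerw l : l < q -> layer (w l) = l.
  move=> ltq; rewrite /w layer0 /o addnA subnKC; last by apply: ltnW.
  by rewrite modnDl modn_small.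
have w0 : w q = w 0 by rewrite /w /v addn0 modnDr.
have stepw l : layer_arc x y (w l) (w l.+1) by rewrite /w addnS.
have e01 : (label (w 0), label (w 1)) \in x.
  by case/and3P: (stepw 0) => _ _; rewrite layerw.
have e12 : label (w 1) = label (w 2).
  case/and3P: (stepw 1) => _ _; rewrite layerw; last lia.
  by move/eqP.
have e23 : (label (w 3), label (w 2)) \in y.
  case/and3P: (stepw 2) => _ _; rewrite layerw //; lia.
have tail l : 3 + l <= q -> label (w (3 + l)) = label (w 3).
  elim: l => [//|l IH] hl; rewrite -IH; last lia.
  case/and3P: (stepw (3 + l)) => _ _; rewrite layerw; last lia.
  by rewrite addnS => /eqP.
have e30 : label (w 0) = label (w 3).
  by rewrite -w0 -(tail (q - 3)); [rewrite subnKC //; lia|lia].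
move: e23; rewrite -e30 -e12 => ey.
by move: dxy; rewrite disjoint_subset => /subsetP/(_ _ e01); rewrite inE ey.
Qed.

End LayeredGraph.

(** * The round lower bound *)

Lemma congest_bound (n' m' q B k T : nat) (A : congest_algo n'.+1 B k) :
  4 <= q -> q * m'.+1 <= n'.+1 -> detects_whp A q T ->
  m'.+1 * m'.+1 %/ 80 <= 19 + 20 * B.+1 * T * m'.+1.
Proof.
move=> q4 qmn det; set m := m'.+1.
(* The random bits of all nodes together serve as the shared coins of the two players. *)
pose tr (r : {ffun 'I_n'.+1 -> k.-tuple bool}) (x y : {set 'I_m * 'I_m}) :=
  transcript T A r (@cut n' m' q) (@alice n' m') (layer_arc q x y).
have tr_rect r : rectangular (tr r).
  move=> x y x' y' same.
  apply: transcript_cut_paste same => u v.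
  - exact: layer_arc_alice.
  - exact: layer_arc_bob.
  - exact: linked_cut.
pose acc (t : {ffun 'I_T * ('I_m * bool * bool) -> option 'I_(2 ^ B)} * (bool * bool)) :=
  ~~ (t.2.1 || t.2.2).
have accE r x y : acc (tr r x y) = ~~ [exists v, out A (states A (layer_arc q x y) r T v)].
  by rewrite /acc -transcript_reports.
have whp x y := det _ (layer_arc_irreflexive q4 qmn x y).
have yes (x y : {set 'I_m * 'I_m}) : [disjoint x & y] ->
    2 * #|{ffun 'I_n'.+1 -> k.-tuple bool}| <= 3 * #|[set r | acc (tr r x y)]|.
  move=> /(disjoint_no_dcycle q4 qmn) nocycle; apply: leq_trans (whp x y) _.
  rewrite leq_mul2l /=; apply: subset_leq_card; apply/subsetP => r.
  by rewrite !inE accE /run_correct (negbTE nocycle) eqbF_neg.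
have no (x y : {set 'I_m * 'I_m}) j : j \in x -> j \in y ->
    3 * #|[set r | acc (tr r x y)]| <= #|{ffun 'I_n'.+1 -> k.-tuple bool}|.
  case: j => i j jx jy; have cyc := meeting_has_dcycle q4 qmn jx jy.
  have := whp x y; rewrite -(cardsC [set r | acc (tr r x y)]).
  rewrite (_ : [set r | run_correct A q T (layer_arc q x y) r] = ~: [set r | acc (tr r x y)]).
    lia.
  by apply/setP => r; rewrite !inE accE /run_correct cyc negbK eqb_id.
have := disjointness_lower_bound tr_rect _ _ yes no.
rewrite !card_prod !card_ffun !card_prod !card_option !card_ord !card_bool.
rewrite card_tuple !card_bool muln_gt0 !expn_gt0 => /(_ isT isT) bound.
(* Two matchings in two directions give 4m messages per round, [B.+1] bits each, plus two verdict
   bits. Five repetitions and the factor [2 ^ 9] give 5 * 2 + 9 = 19 and the coefficient 5 * 4 =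
   20. *)
have card_Th : (2 ^ B).+1 ^ (T * (m * 2 * 2)) * (2 * 2) <= 2 ^ (B.+1 * (T * (m * 2 * 2)) + 2).
  rewrite expnD leq_mul2r [X in _ <= X]expnM; apply: leq_exp2rW.
  by rewrite expnS; have := expn_gt0 2 B; lia.
rewrite -(leq_exp2l (m := 2)) //; apply: leq_trans bound _.
apply: (leq_trans (leq_mul (leqnn _) (leq_exp2rW 5 card_Th))).
by rewrite -expnM -expnD leq_exp2l //; nia.
Qed.

(* For every q >= 4 and every bandwidth constant b (messages of b*ceil(log2 n)
   bits, i.e. O(log n)), there is c > 0 such that for all large n, every
   randomized CONGEST algorithm detecting directed q-cycles w.p. >= 2/3 in T
   rounds has T >= n / (c log n). *)
Theorem theorem4 :
  forall q : nat, 4 <= q ->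
  forall b : nat,
  exists c : nat, 0 < c /\
  exists N : nat, forall n : nat, N <= n ->
  forall (k T : nat) (A : congest_algo n (b * up_log 2 n) k),
    detects_whp A q T -> n <= c * T * trunc_log 2 n.
Proof.
(* With m = n/q rounded down, n < q (m + 1) <= 2 q m turns the constant 80 * 40 of the bound on m
   into 80 * 80 * q; the factor 2 b + 1 comes from replacing [up_log] by [trunc_log]. *)
move=> q q4 b; exists (80 * 80 * q * (2 * b + 1)); split.
  by rewrite !muln_gt0 addn1 (leq_trans _ q4).
exists (80 * 40 * q) => n nN k T A det.
have n2 : 1 < n by nia.
have q0 : 0 < q by lia.
have Ln : 0 < trunc_log 2 n by rewrite trunc_log_gt0.
have up : up_log 2 n <= (trunc_log 2 n).+1.
  by rewrite up_log_trunc_log // ltnS leq_trunc_log // leq_pred.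
have m_big : 80 * 40 <= n %/ q by rewrite leq_divRL.
have n_small : n < (n %/ q).+1 * q by apply: ltn_ceil.
have qm : q * (n %/ q) <= n by rewrite mulnC leq_divM.
case: n nN A det n2 Ln up m_big n_small qm => // n'.
move: (n'.+1 %/ q) => [//|m'] nN A det n2 Ln up m_big n_small qm.
have := congest_bound q4 qm det.
move: (trunc_log 2 n'.+1) (up_log 2 n'.+1) Ln up => L U L0 LU.
set m := m'.+1 in m_big n_small qm *; move=> bound.
have mm : m * m < 80 * 20 + 80 * 20 * ((b * U).+1 * T * m) by lia.
(* Since m is at least 80 * 40, the additive 80 * 20 is absorbed by doubling the coefficient; this
   also excludes [T] = 0. *)
have m_lt : m < 80 * 40 * ((b * U).+1 * T) by nia.
have BU : (b * U).+1 <= (2 * b + 1) * L by nia.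
have := leq_mul BU (leqnn T); move: n_small m_lt; nia.
Qed.
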